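(* Let $n$ be a positive integer and let $d$ be a positive divisor of $n$ with $\gcd(d,n/d)=1$. Then $K_d\otimes K_{n/d}\simeq \mathrm{ICG}_n\big(\{d_1d_2 \mid d_1\in D_d,\ d_2\in D_{n/d}\}\big)$.
   Context: $K_r$ is the complete graph on $r$ vertices. The tensor product $G\otimes H$ has vertex set $V(G)\times V(H)$, with $(u,u')$ adjacent to $(v,v')$ iff $u\sim v$ in $G$ and $u'\sim v'$ in $H$. For a positive integer $m$, $D_m$ denotes the set of positive divisors of $m$ other than $m$ itself. For $D\subseteq D_n$, the integral circulant graph $\mathrm{ICG}_n(D)$ is the graph on $\mathbb{Z}_n=\{0,\ldots,n-1\}$ in which $i$ and $j$ are adjacent iff $\gcd(i-j,n)\in D$ (equivalently, the circulant graph with symbol $\bigcup_{\delta\in D}\{k: 1\le k\le n-1,\ \gcd(k,n)=\delta\}$). *)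

(* Defs.v *)
From mathcomp Require Import all_boot all_order all_algebra.
Set Implicit Arguments.
Unset Strict Implicit.
Unset Printing Implicit Defensive.

(* A finite simple graph is given by its adjacency relation on a finite type
   of vertices; symmetry and irreflexivity are proved for each construction. *)

Definition graph_iso (T U : finType) (G : rel T) (H : rel U) : Prop :=
  exists2 f : T -> U, bijective f & forall x y : T, H (f x) (f y) = G x y.

Definition complete_graph (r : nat) : rel 'I_r := fun i j => i != j.
Arguments complete_graph r i j : clear implicits.

Definition tensor_graph (T U : finType) (G : rel T) (H : rel U) :
    rel (T * U)%type :=
  fun x y => G x.1 y.1 && H x.2 y.2.

Definition proper_divisors (m : nat) : seq nat :=
  [seq k <- divisors m | k != m].

(* The finite set D of naturals is represented by any sequence enumerating it;
   only membership matters. The difference i - j is taken in int. *)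
Definition ICG (n : nat) (D : seq nat) : rel 'I_n :=
  fun i j => gcdn `|(i%:Z - j%:Z)%R|%N n \in D.
Arguments ICG n D i j : clear implicits.

Lemma mem_proper_divisors (m k : nat) :
  0 < m -> (k \in proper_divisors m) = (k %| m) && (k != m).
Proof. by move=> m0; rewrite mem_filter -dvdn_divisors // andbC. Qed.

Lemma divisor_products_sub (n d : nat) : 0 < n -> d %| n ->
  {subset [seq d1 * d2 | d1 <- proper_divisors d,
                         d2 <- proper_divisors (n %/ d)]
   <= proper_divisors n}.
Proof.
move=> n0 dn k /allpairsP[[x y] /= [xD yD ->]].
have d0 : 0 < d by apply: dvdn_gt0 dn.
have q0 : 0 < n %/ d by rewrite divn_gt0 // dvdn_leq.
move: xD yD; rewrite !mem_proper_divisors // => /andP[xd xnd] /andP[yd ynd].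
have En : n = d * (n %/ d) by rewrite mulnC divnK.
rewrite {1}En dvdn_mul //= neq_ltn {1}En.
have xlt : x < d by rewrite ltn_neqAle xnd dvdn_leq.
have ylt : y < n %/ d by rewrite ltn_neqAle ynd dvdn_leq.
by rewrite ltn_mul.
Qed.

Lemma complete_graph_simple (r : nat) :
  symmetric (complete_graph r) /\ irreflexive (complete_graph r).
Proof.
by split=> [i j|i]; rewrite /complete_graph ?eqxx // eq_sym.
Qed.

Lemma tensor_graph_simple (T U : finType) (G : rel T) (H : rel U) :
  symmetric G /\ irreflexive G -> symmetric H /\ irreflexive H ->
  symmetric (tensor_graph G H) /\ irreflexive (tensor_graph G H).
Proof.
move=> [sG iG] [sH iH]; split=> [x y|x]; rewrite /tensor_graph.
  by rewrite sG sH.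
by rewrite iG.
Qed.

Lemma ICG_simple (n : nat) (D : seq nat) :
  {subset D <= proper_divisors n} -> symmetric (ICG n D) /\ irreflexive (ICG n D).
Proof.
move=> sD; split=> [i j|i]; rewrite /ICG.
  by rewrite distnC.
rewrite GRing.subrr absz0 gcd0n; apply/negP => /sD.
by rewrite mem_filter eqxx.
Qed.

(* Main.v *)
Require Import Defs.
From mathcomp Require Import all_boot all_order all_algebra.

(** By the Chinese remainder theorem, [(a, b)] is sent to the residue mod [n]
that is [a] mod [d] and [b] mod [n %/ d]. The gcd of [k] with [n] splits as
[gcdn k d * gcdn k (n %/ d)], and its two factors are proper divisors exactly
when neither [d] nor [n %/ d] divides [k]; for [k] a difference of residues
this is adjacency in the tensor product. *)

Lemma gcdn_coprime_mulr (k d m : nat) :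
  coprime d m -> gcdn k (d * m) = gcdn k d * gcdn k m.
Proof.
move=> co_dm; apply/eqP; rewrite eqn_dvd; apply/andP; split.
  (* The product of gcds is the gcd of [k * k], [d * k], [k * m] and [d * m]. *)
  rewrite muln_gcdr !muln_gcdl !dvdn_gcd dvdn_gcdr.
  have gk : gcdn k (d * m) %| k := dvdn_gcdl _ _.
  by rewrite ![_ %| k * _]dvdn_mulr // dvdn_mull.
rewrite dvdn_gcd dvdn_mul ?dvdn_gcdr // Gauss_dvd ?dvdn_gcdl //.
exact: coprime_dvdl (dvdn_gcdr _ _) (coprime_dvdr (dvdn_gcdr _ _) co_dm).
Qed.

Lemma gcdn_mem_proper_products (k d m : nat) :
  0 < d -> 0 < m -> coprime d m ->
  (gcdn k (d * m) \in [seq d1 * d2 | d1 <- proper_divisors d,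
                                     d2 <- proper_divisors m])
  = ~~ (d %| k) && ~~ (m %| k).
Proof.
move=> d_gt0 m_gt0 co_dm; apply/allpairsP/andP => [[[x y] /= []]|[ndk nmk]].
  rewrite !mem_proper_divisors // => /andP[xd x_neq] /andP[ym y_neq] gcdE.
  (* Since [y] is coprime to [d], [d %| x * y] would force [d %| x], hence [x = d]; likewise for [m]
     and [y]. *)
  have dvdE z : z %| d * m -> (z %| k) = (z %| x * y).
    by move=> zdm; rewrite -gcdE dvdn_gcd zdm andbT.
  split.
    rewrite (dvdE _ (dvdn_mulr _ (dvdnn _))) Gauss_dvdl;
      last exact: coprime_dvdr ym co_dm.
    by apply: contra x_neq => dx; rewrite eqn_dvd xd.
  rewrite (dvdE _ (dvdn_mull _ (dvdnn _))) Gauss_dvdr;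
    last by rewrite coprime_sym (coprime_dvdl xd).
  by apply: contra y_neq => my; rewrite eqn_dvd ym.
exists (gcdn k d, gcdn k m); rewrite /= !mem_proper_divisors // !dvdn_gcdr /=.
split; last exact: gcdn_coprime_mulr.
  by apply: contra ndk => /eqP <-; apply: dvdn_gcdl.
by apply: contra nmk => /eqP <-; apply: dvdn_gcdl.
Qed.

Lemma dvdn_distn (c i j : nat) :
  (c %| `|(i%:Z - j%:Z)%R|) = (i == j %[mod c]).
Proof.
by have := eqz_mod_dvd c i j; rewrite !modz_nat => /esym.
Qed.

Theorem theorem4p3 (n d : nat) (n_gt0 : 0 < n) (d_dvd_n : d %| n)
    (co_d_nd : coprime d (n %/ d)) :
  graph_iso
    (tensor_graph (complete_graph d) (complete_graph (n %/ d)))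
    (ICG n [seq d1 * d2 | d1 <- proper_divisors d,
                          d2 <- proper_divisors (n %/ d)]).
Proof.
move: co_d_nd; set m := n %/ d => co_dm.
have nE : n = d * m by rewrite mulnC divnK.
have [d_gt0 m_gt0] : 0 < d /\ 0 < m by apply/andP; rewrite -muln_gt0 -nE.
(* [chinese] returns an unreduced number; reducing it mod [n] keeps its residues, as [d] and [m]
   divide [n]. *)
pose f (x : 'I_d * 'I_m) : 'I_n :=
  Ordinal (ltn_pmod (chinese d m x.1 x.2) n_gt0).
have f_modd x : f x = x.1 %[mod d].
  by rewrite /= modn_dvdm // chinese_modl.
have f_modm x : f x = x.2 %[mod m].
  by rewrite /= modn_dvdm ?chinese_modr // nE dvdn_mull.
have f_inj : injective f.
  move=> [a b] [a' b'] eqf; congr pair; apply: val_inj => /=.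
    by have := f_modd (a, b); rewrite eqf f_modd /= !modn_small.
  by have := f_modm (a, b); rewrite eqf f_modm /= !modn_small.
exists f => [|x y].
  by apply: inj_card_bij => //; rewrite card_prod !card_ord -nE.
(* Both adjacencies become non-congruence mod [d] and mod [m]; for coordinates below the modulus,
   congruence is equality. *)
rewrite /ICG [X in gcdn _ X]nE gcdn_mem_proper_products // !dvdn_distn.
by rewrite !f_modd !f_modm !modn_small.
Qed.
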